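(* Let $K$ be a finitely presented $\mathbb{Z}$-group and let $r\in\{2,3,4\}$. If $K$ contains infinitely many subgroups of index $r$, then for every integer $m\ge r!$ the group $K$ contains uncountably many subgroups of index $m$.
   Context: A finitely presented $\mathbb{Z}$-group is a group $K$ of the form $K=\ker\chi$, where $G$ is a finitely presented group and $\chi: G\to\mathbb{Z}$ is an epimorphism. ($K$ itself need not be finitely generated.) Subgroups are not required to be normal and are counted as subgroups, not up to conjugacy. *)

(* Defs.v *)
From HB Require Import structures.
From mathcomp Require Import all_boot all_algebra.
From mathcomp Require Import all_classical.

Set Implicit Arguments.
Unset Strict Implicit.
Unset Printing Implicit Defensive.

Local Open Scope classical_set_scope.
Local Open Scope group_scope.

(** A letter [(i, b)] stands for the generator [x_i] if [b = false] and for
    [x_i^-1] if [b = true]. *)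
Notation letter n := ('I_n * bool)%type.

Definition letterV n (x : letter n) : letter n := (x.1, ~~ x.2).

(** A word is reduced when no letter is followed by its inverse. *)
Definition reduced n (w : seq (letter n)) : bool :=
  sorted (fun x y => y != letterV x) w.

(** The reduced form of [x w], for a reduced word [w]. *)
Definition push n (x : letter n) (w : seq (letter n)) : seq (letter n) :=
  if w is y :: w' then if y == letterV x then w' else x :: w else [:: x].

Definition wmul n (u v : seq (letter n)) : seq (letter n) := foldr (@push n) v u.

Definition winv n (u : seq (letter n)) : seq (letter n) :=
  rev (map (@letterV n) u).

Lemma letterVK n : involutive (@letterV n).
Proof. by case=> i b; rewrite /letterV /= negbK. Qed.

Lemma reduced_push n (x : letter n) w : reduced w -> reduced (push x w).
Proof.
case: w => [|y w] //= yw; case: ifP => [_|/negbT neq]; first exact: path_sorted yw.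
by rewrite /= neq.
Qed.

Lemma reduced_wmul n (u v : seq (letter n)) : reduced v -> reduced (wmul u v).
Proof. by move=> vr; elim: u => //= x u; apply: reduced_push. Qed.

Lemma reduced_winv n (u : seq (letter n)) : reduced u -> reduced (winv u).
Proof.
rewrite /reduced /winv rev_sorted sorted_map; apply: sub_sorted => x y /=.
by rewrite letterVK eq_sym.
Qed.

Lemma pushK n (x : letter n) w : reduced w -> push x (push (letterV x) w) = w.
Proof.
case: w => [|y w] /=; first by rewrite eqxx.
rewrite letterVK; case: (eqVneq y x) => [->|_] yw; last by rewrite /= eqxx.
by case: w yw => //= z w /andP[/negbTE ->].
Qed.

Lemma wmul_push n (x : letter n) u w :
  reduced w -> wmul (push x u) w = push x (wmul u w).
Proof.
case: u => //= y u wr; case: eqP => [->|//].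
by rewrite pushK //; apply: reduced_wmul.
Qed.

Lemma wmulA n (u v w : seq (letter n)) :
  reduced w -> wmul u (wmul v w) = wmul (wmul u v) w.
Proof. by move=> wr; elim: u => //= x u IHu; rewrite wmul_push // IHu. Qed.

Lemma wmulw1 n (u : seq (letter n)) : reduced u -> wmul u [::] = u.
Proof.
elim: u => //= x u IHu xu; have ur : reduced u := path_sorted xu.
rewrite IHu // {IHu ur}.
by case: u xu => //= y u /andP[/negbTE ->].
Qed.

Lemma wmulVw n (u : seq (letter n)) : wmul (winv u) u = [::].
Proof.
elim: u => //= x u IHu.
by rewrite /winv /= rev_cons /wmul foldr_rcons /= letterVK eqxx.
Qed.

Lemma winvK n : involutive (@winv n).
Proof. by move=> u; rewrite /winv map_rev revK mapK //; apply: letterVK. Qed.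

Lemma wmulwV n (u : seq (letter n)) : wmul u (winv u) = [::].
Proof. by rewrite -{1}[u]winvK wmulVw. Qed.

(** The free group of rank [n], as the group of reduced words. *)
Record free_group (n : nat) : Type :=
  FreeGroup { word_of :> seq (letter n); word_ofP : reduced word_of }.

HB.instance Definition _ n := [isSub for @word_of n].
HB.instance Definition _ n := [Choice of free_group n by <:].

Section FreeGroup.
Variable n : nat.
Implicit Types u v w : free_group n.

Definition fg_one : free_group n := @FreeGroup n [::] isT.
Definition fg_mul u v : free_group n :=
  FreeGroup (@reduced_wmul n u v (word_ofP v)).
Definition fg_inv u : free_group n := FreeGroup (reduced_winv (word_ofP u)).

Lemma fg_mulA : associative fg_mul.
Proof. by move=> u v w; apply/val_inj/wmulA/word_ofP. Qed.
Lemma fg_mul1 : left_id fg_one fg_mul.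
Proof. by move=> u; apply/val_inj. Qed.
Lemma fg_mulr1 : right_id fg_one fg_mul.
Proof. by move=> u; apply/val_inj/wmulw1/word_ofP. Qed.
Lemma fg_mulV : left_inverse fg_one fg_inv fg_mul.
Proof. by move=> u; apply/val_inj/wmulVw. Qed.
Lemma fg_mulrV : right_inverse fg_one fg_inv fg_mul.
Proof. by move=> u; apply/val_inj/wmulwV. Qed.

HB.instance Definition _ := isGroup.Build (free_group n)
  fg_mulA fg_mul1 fg_mulr1 fg_mulV fg_mulrV.
End FreeGroup.

Definition is_subgroup (G : groupType) (H : set G) : Prop :=
  [/\ H 1, forall x y, H x -> H y -> H (x * y) & forall x, H x -> H x^-1].

Definition is_normal_subgroup (G : groupType) (N : set G) : Prop :=
  is_subgroup N /\ forall x y, N x -> N (x ^ y).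

Definition normal_closure (G : groupType) (S : set G) : set G :=
  smallest (@is_normal_subgroup G) S.

Definition left_cosets (G : groupType) (H : set G) : set (set G) :=
  [set [set x * h | h in H] | x in [set: G]].

Definition has_index (G : groupType) (H : set G) (m : nat) : Prop :=
  (left_cosets H #= `I_m)%card.

Definition subgroups_of_index (G : groupType) (m : nat) : set (set G) :=
  [set H | is_subgroup H /\ has_index H m].

Arguments subgroups_of_index : clear implicits.

(** [G] is isomorphic to the quotient of a free group of finite rank by the
    normal closure of finitely many relators. *)
Definition finitely_presented (G : groupType) : Prop :=
  exists (n : nat) (R : seq (free_group n)) (f : free_group n -> G),
    [/\ {morph f : x y / x * y},
        range f = [set: G] &
        f @^-1` [set 1] = normal_closure [set` R]].

(** [K] is isomorphic, via [iota], to the kernel of an epimorphism [chi] from a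
    finitely presented group onto the additive group of integers. *)
Definition finitely_presented_Z_group (K : groupType) : Prop :=
  exists (G : groupType) (chi : G -> int) (iota : K -> G),
    [/\ finitely_presented G,
        {morph chi : x y / x * y >-> (x + y)%R} /\ range chi = [set: int] &
        [/\ {morph iota : x y / x * y}, injective iota &
            range iota = chi @^-1` [set 0%R]]].

(* Main.v *)
(** Let [t] be an element of the finitely presented group [G] with [chi t = 1].
    The kernel [K] is generated by the translates [t^-(k + chi x) x t^k] of the
    generators [x] of [G], and its relations are translates of finitely many
    relations: [K] has a presentation in which generators sit on levels and each
    relation involves boundedly many consecutive levels.  Hence homomorphisms
    from [K] which agree on a long window of levels can be spliced there.

    The symmetric group on [r <= 4] letters is solvable, so dividing out minimal
    normal subgroups yields a finite group [S] of order at most [r!], an abelian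
    normal subgroup [M] of [S], and [phi0 : K -> S] with infinitely many
    [phi : K -> S] equal to [phi0] modulo [M].  These [phi] form a torsor under
    an abelian group, and the pigeonhole principle on windows gives such [phi]
    which differ from [phi0] only on a bounded range of levels, arbitrarily far
    away.  Splicing them gives one [phi] which differs from [phi0] somewhere in
    each of infinitely many disjoint blocks of levels.

    [K] acts on [S] by [y |-> (phi0 x)^-1 y (phi x)].  Outside the blocks this is
    a conjugation, which fixes [1]; inside each block [1] moves.  Adjoin
    [e = m - |orbit of 1|] fixed points.  In each block the action may be
    conjugated independently by a transposition of [1] and an extra point, which
    makes [1] a fixed point of that block.  Finitely many blocks are used to make
    the orbit of [1] of size [m]; the others are switched freely, and the
    stabilizer of [1] remembers all the choices. *)

Require Import Defs.
From mathcomp Require Import all_boot all_algebra.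
From mathcomp Require Import all_fingroup all_solvable all_character.
From mathcomp Require Import all_classical.
From mathcomp Require Import zify.

Set Implicit Arguments.
Unset Strict Implicit.
Unset Printing Implicit Defensive.

Local Open Scope classical_set_scope.
Local Open Scope group_scope.

(** * Group morphisms and presentations by levels *)

Section Morphisms.
Variables (G T : groupType) (f : G -> T).
Hypothesis fM : {morph f : x y / x * y}.

Lemma morphic1 : f 1 = 1.
Proof. by apply: (@mulgI _ (f 1)); rewrite -fM !mulg1. Qed.

Lemma morphicV x : f x^-1 = (f x)^-1.
Proof. by apply: (@mulgI _ (f x)); rewrite -fM !mulgV morphic1. Qed.

End Morphisms.

Lemma subgroup_eq (G T : groupType) (f g : G -> T) :
  {morph f : x y / x * y} -> {morph g : x y / x * y} ->
  is_subgroup [set x | f x = g x].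
Proof.
move=> fM gM; split=> [|x y /= fgx fgy|x /= fgx].
- by rewrite /= !morphic1.
- by rewrite fM gM fgx fgy.
- by rewrite !morphicV // fgx.
Qed.

(* The generator [gen l i] sits on level [l].  The gluing clause says that all
   relations between the generators follow from relations each of which
   involves only [L] consecutive levels. *)
Record local_presentation (K : groupType) (I : finType) (gen : nat -> I -> K)
    (L : nat) : Prop := LocalPresentation {
  lp_gen : forall H : set K,
    is_subgroup H -> (forall l i, H (gen l i)) -> forall x, H x;
  lp_glue : forall (T : groupType) (p : nat -> I -> T),
    (forall k, exists2 phi : K -> T, {morph phi : x y / x * y} &
       forall l i, (k <= l < k + L)%N -> phi (gen l i) = p l i) ->
    exists2 phi : K -> T, {morph phi : x y / x * y} &
      forall l i, phi (gen l i) = p l i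
}.

(** * Words acting on pairs of a height and a value *)

Section WordAction.
Variables (n : nat) (d : 'I_n -> int) (T : groupType).
Implicit Types (p : int -> 'I_n -> T) (x : letter n) (w : seq (letter n)).

(** A skew product over the heights. An inverse letter reads [p] at the height where it arrives, so
    that it undoes the positive letter exactly. *)
Definition letter_act p x (q : int * T) : int * T :=
  if x.2 then ((q.1 - d x.1)%R, (p (q.1 - d x.1)%R x.1)^-1 * q.2)
  else ((q.1 + d x.1)%R, p q.1 x.1 * q.2).

Definition word_act p w (q : int * T) : int * T := foldr (letter_act p) q w.

Definition letter_shift x : int := if x.2 then (- d x.1)%R else d x.1.
Definition word_shift w : int := (\sum_(x <- w) letter_shift x)%R.

Lemma letter_actK p x q : letter_act p x (letter_act p (letterV x) q) = q.
Proof.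
case: x q => i [] [k y]; rewrite /letter_act /=.
  by rewrite GRing.addrK mulKg.
by rewrite GRing.subrK mulVKg.
Qed.

Lemma word_act_push p x w q :
  word_act p (push x w) q = letter_act p x (word_act p w q).
Proof.
case: w => //= y w; case: eqP => [->|//].
by rewrite letter_actK.
Qed.

Lemma word_act_mul p u v q :
  word_act p (wmul u v) q = word_act p u (word_act p v q).
Proof. by elim: u => //= x u IHu; rewrite word_act_push IHu. Qed.

Lemma word_act1 p w q : (word_act p w q).1 = (q.1 + word_shift w)%R.
Proof.
elim: w => [|x w IHw] /=; first by rewrite /word_shift big_nil GRing.addr0.
rewrite /word_shift big_cons -/(word_shift w) /letter_act /letter_shift.
by case: ifP => _ /=; rewrite IHw; lia.
Qed.

Lemma word_act_mulr p w q z :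
  word_act p w (q.1, q.2 * z) = ((word_act p w q).1, (word_act p w q).2 * z).
Proof.
elim: w => //= x w ->; rewrite /letter_act /=.
by case: ifP => _ /=; rewrite mulgA.
Qed.

(* A bound on the displacement of the letters bounds the heights visited by a
   word, hence the part of [p] on which its action depends. *)
Lemma word_act_local (M : nat) p p' w k y :
  (forall i, (`|d i| <= M)%N) ->
  (forall k', (`|k' - k| <= M * size w)%N -> p k' =1 p' k') ->
  word_act p w (k, y) = word_act p' w (k, y).
Proof.
move=> dM; suff: (forall k', (`|k' - k| <= M * size w)%N -> p k' =1 p' k') ->
  word_act p w (k, y) = word_act p' w (k, y) /\
  (`|(word_act p w (k, y)).1 - k| <= M * size w)%N.
  by move=> h /h[].
elim: w => [|x w IHw] pp' /=; first by split=> //; lia.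
have [k' k'M|eqw lew] := IHw; first by apply: pp' => /=; lia.
rewrite -{}eqw; move: (word_act p w _) lew => [k1 y1] /= lek1.
have := dM x.1; rewrite /letter_act /=; case: ifP => _ /= di.
  by rewrite pp' /=; [split=> //|]; lia.
by rewrite pp' /=; [split=> //|]; lia.
Qed.

End WordAction.

Section FreeGroupMorphism.
Variables (n : nat) (G : groupType) (f : free_group n -> G).
Hypothesis fM : {morph f : x y / x * y}.

Definition fg_letter (x : letter n) : free_group n :=
  @FreeGroup n [:: x] isT.

Lemma fg_letterV x : fg_letter (letterV x) = (fg_letter x)^-1.
Proof. exact: val_inj. Qed.

Lemma fg_word_ind (P : seq (letter n) -> G -> Prop) :
  P [::] 1 ->
  (forall x w g, P w g -> P (x :: w) (f (fg_letter x) * g)) ->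
  forall u, P (word_of u) (f u).
Proof.
move=> P1 PM [w wr] /=.
elim: w wr => [|x w IHw] xwr.
  by rewrite (_ : FreeGroup xwr = 1) ?morphic1 //; apply: val_inj.
have wr : reduced w := path_sorted xwr.
rewrite (_ : FreeGroup xwr = fg_letter x * FreeGroup wr); last first.
  apply: val_inj => /=; case: w xwr {IHw wr} => //= y w /andP[].
  by move=> /negbTE ->.
by rewrite fM; apply: PM; apply: IHw.
Qed.

End FreeGroupMorphism.

(** Once the relators act trivially, so does their whole normal closure, and the action descends to
    the presented group. *)
Lemma word_act_normal (n : nat) (d : 'I_n -> int) (T : groupType)
    (p : int -> 'I_n -> T) :
  is_normal_subgroup [set u : free_group n | forall q, word_act d p u q = q].
Proof.
have actM (u v : free_group n) q :
    word_act d p (u * v) q = word_act d p u (word_act d p v q).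
  exact: word_act_mul.
have actV (u : free_group n) q : word_act d p u^-1 (word_act d p u q) = q.
  by rewrite -actM mulVg.
split; first split=> // [u v pu pv q|u pu q].
- by rewrite actM pv pu.
- by rewrite -{1}[q]pu actV.
by move=> u v pu q; rewrite /mkset conjgE !actM pu; apply: actV.
Qed.

(** * Local presentation of the kernel, in the manner of Reidemeister and Schreier *)

Section KernelPresentation.
Variables (K G : groupType) (chi : G -> int) (iota : K -> G).
Variables (n : nat) (R : seq (free_group n)) (f : free_group n -> G).
Hypothesis fM : {morph f : x y / x * y}.
Hypothesis f_surj : range f = [set: G].
Hypothesis ker_f : f @^-1` [set 1] = normal_closure [set` R].
Hypothesis chiM : {morph chi : x y / x * y >-> (x + y)%R}.
Hypothesis chi_surj : range chi = [set: int].
Hypothesis iotaM : {morph iota : x y / x * y}.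
Hypothesis iota_inj : injective iota.
Hypothesis im_iota : range iota = chi @^-1` [set 0%R].

Let chi1 : chi 1 = 0%R.
Proof. by have := chiM 1 1; rewrite mulg1; lia. Qed.

Let chiV x : chi x^-1 = (- chi x)%R.
Proof. by have := chiM x x^-1; rewrite mulgV chi1; lia. Qed.

Let t : G := xget 1 (chi @^-1` [set 1%R]).

Let chi_t : chi t = 1%R.
Proof.
rewrite /t; case: xgetP => // nex.
have: [set: int] 1%R by [].
by rewrite -chi_surj => -[x _ x1]; have := nex x; rewrite /= x1.
Qed.

Let s (k : int) : G := match k with Posz m => t ^+ m | Negz m => t ^- m.+1 end.

Let s0 : s 0%R = 1. Proof. by []. Qed.

Let s_succ k : s (k + 1)%R = t * s k.
Proof.
case: k => [m|[|m]].
- rewrite (_ : (m%:Z + 1)%R = m.+1); last by lia.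
  exact: expgS.
- exact/esym/mulgV.
rewrite (_ : (Negz m.+1 + 1)%R = Negz m) /=; last by lia.
by rewrite (expgSr t m.+1) invgM mulVKg.
Qed.

Let chi_s k : chi (s k) = k.
Proof.
have chi_pow m : chi (t ^+ m) = Posz m.
  elim: m => [|m IHm]; first by rewrite expg0 chi1.
  by rewrite expgS chiM IHm chi_t; lia.
by case: k => m /=; rewrite ?chiV chi_pow //; lia.
Qed.

Let h (x : G) : K := xget 1 (iota @^-1` [set x]).

Let iota_h x : chi x = 0%R -> iota (h x) = x.
Proof.
move=> x0; rewrite /h; case: xgetP => // nex.
have: (chi @^-1` [set 0%R]) x by [].
by rewrite -im_iota => -[y _ yx]; case: (nex y).
Qed.

Let hM x y : chi x = 0%R -> chi y = 0%R -> h (x * y) = h x * h y.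
Proof.
move=> x0 y0; apply: iota_inj.
by rewrite iotaM !iota_h // chiM x0 y0 GRing.addr0.
Qed.

Let hK x : h (iota x) = x.
Proof.
apply: iota_inj; rewrite iota_h //.
have: range iota (iota x) by exists x.
by rewrite im_iota.
Qed.

Let g (i : 'I_n) : G := f (fg_letter (i, false)).
Let d (i : 'I_n) : int := chi (g i).

(* The element of [ker chi] by which [x] acts from the [k]-th to the
   [k + chi x]-th coset of [ker chi], relatively to the transversal [s]. *)
Let cocycle (x : G) (k : int) : K := h ((s (k + chi x))^-1 * (x * s k)).

Let chi_cocycle x k : chi ((s (k + chi x))^-1 * (x * s k)) = 0%R.
Proof. by rewrite !chiM chiV !chi_s; lia. Qed.

Let cocycleM x y k : cocycle (x * y) k = cocycle x (k + chi y) * cocycle y k.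
Proof.
rewrite /cocycle -hM ?chi_cocycle //; congr h.
rewrite chiM (_ : (k + (chi x + chi y) = k + chi y + chi x)%R); last by lia.
by rewrite -!mulgA mulVKg.
Qed.

Let cocycle1 k : cocycle 1 k = 1.
Proof.
apply: iota_inj; rewrite iota_h ?chi_cocycle // chi1 GRing.addr0 mul1g mulVg.
by rewrite morphic1.
Qed.

Let cocycle_t k : cocycle t k = 1.
Proof.
apply: iota_inj; rewrite iota_h ?chi_cocycle // chi_t s_succ mulVg.
by rewrite morphic1.
Qed.

Let f_letter i (b : bool) :
  f (fg_letter (i, b)) = if b then (g i)^-1 else g i.
Proof.
case: b => //; rewrite -(morphicV fM); congr f.
exact: (fg_letterV (i, false)).
Qed.

Let word_shiftE (u : free_group n) : word_shift d u = chi (f u).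
Proof.
apply: (fg_word_ind fM (P := fun w x => word_shift d w = chi x)).
  by rewrite chi1 /word_shift big_nil.
move=> [i b] w x IHw.
rewrite /word_shift big_cons -/(word_shift d w) IHw chiM f_letter.
by rewrite /letter_shift /=; case: b; rewrite ?chiV.
Qed.

Let word_act_hom (T : groupType) (phi : K -> T) (u : free_group n) k y :
  {morph phi : x y / x * y} ->
  word_act d (fun k i => phi (cocycle (g i) k)) u (k, y)
  = ((k + chi (f u))%R, phi (cocycle (f u) k) * y).
Proof.
move=> phiM; apply: (fg_word_ind fM (P := fun w x => word_act _ _ w _ =
  ((k + chi x)%R, phi (cocycle x k) * y))).
  by rewrite chi1 GRing.addr0 cocycle1 morphic1 // mul1g.
move=> [i b] w x /= ->; rewrite f_letter cocycleM phiM chiM -mulgA.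
rewrite /letter_act /=; case: b => /=; last by congr pair; rewrite /d; lia.
rewrite chiV /d; congr pair; first by lia.
rewrite -morphicV //; congr (phi _ * _).
apply: (@mulgI _ (cocycle (g i) (k + chi x - chi (g i)))).
rewrite mulgV -chiV -cocycleM.
by rewrite mulgV cocycle1.
Qed.

(** Integer heights are folded onto natural levels: [Posz l] and [Negz l] share the level [l], and
    the boolean tells them apart. *)
Let gen (l : nat) (ib : 'I_n * bool) : K :=
  cocycle (g ib.1) (if ib.2 then Negz l else Posz l).

Let gen_ker (H : set K) :
  is_subgroup H -> (forall l i, H (gen l i)) -> forall x, H x.
Proof.
case=> H1 HM HV Hgen x.
have Hcocycle i k : H (cocycle (g i) k).
  by case: k => k; [have := Hgen k (i, false) | have := Hgen k (i, true)].
suff Hf (u : free_group n) : forall k, H (cocycle (f u) k).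
  have [u _ ux] : range f (iota x) by rewrite f_surj.
  have chix : chi (iota x) = 0%R.
    by have: range iota (iota x) by [exists x]; rewrite im_iota.
  have := Hf u 0%R; rewrite /cocycle ux chix GRing.addr0 s0 invg1 mul1g mulg1.
  by rewrite hK.
apply: (fg_word_ind fM (P := fun _ y => forall k, H (cocycle y k))).
  by move=> k; rewrite cocycle1.
move=> [i b] _ y IHy k; rewrite cocycleM; apply: (HM) => //.
rewrite f_letter; case: b => //.
rewrite (_ : cocycle _ _ = (cocycle (g i) (k + chi y - chi (g i)))^-1).
  exact: HV.
apply: (@mulIg _ (cocycle (g i) (k + chi y - chi (g i)))).
rewrite mulVg -{1}[(k + chi y)%R](GRing.subrK (chi (g i))) -cocycleM.
by rewrite mulVg cocycle1.
Qed.

Let f_ex x : exists u, f u = x.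
Proof.
have [u _ <-] : range f x by rewrite f_surj.
by exists u.
Qed.

Let word_act_ker (T : groupType) (p : int -> 'I_n -> T) :
  (forall r, r \in R -> forall q, word_act d p (word_of r) q = q) ->
  forall u v q, f u = f v ->
    word_act d p (word_of u) q = word_act d p (word_of v) q.
Proof.
move=> pR u v q fuv.
have: (f @^-1` [set 1]) (v^-1 * u).
  by rewrite /preimage /= fM (morphicV fM) fuv mulVg.
rewrite ker_f => /(_ _ (conj (word_act_normal d p) pR)) kuv.
rewrite -{1}(mulVKg v u) [LHS]word_act_mul; congr word_act; exact: kuv.
Qed.

(** A word of the list only sees heights within [D] of its start, so the local homomorphisms force
    the relators to act trivially and [ut] to change only the height. The action then descends to
    [G], and its value at height 0, restricted to [K], is the glued homomorphism. The condition on
    [ut] trivializes the transversal [s]. *)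
Let glue (T : groupType) (p : int -> 'I_n -> T) (M D : nat)
    (ut : free_group n) :
  f ut = t ->
  (forall i, (`|d i| <= M)%N) ->
  (forall u, u \in ut :: R -> (M * size (word_of u) <= D)%N) ->
  (forall k, exists2 phi : K -> T, {morph phi : x y / x * y} &
     forall k' i, (`|k' - k| <= D)%N -> phi (cocycle (g i) k') = p k' i) ->
  exists2 phi : K -> T, {morph phi : x y / x * y} &
     forall k i, phi (cocycle (g i) k) = p k i.
Proof.
move=> fut dM wD loc.
have act_loc k : exists2 phi : K -> T, {morph phi : x y / x * y} &
    forall u y, u \in ut :: R -> word_act d p (word_of u) (k, y) =
      ((k + chi (f u))%R, phi (cocycle (f u) k) * y).
  have [phi phiM phip] := loc k; exists phi => // u y uR.
  rewrite -word_act_hom //; apply: (word_act_local (M := M)) => // k' k'u i.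
  by rewrite phip //; apply: leq_trans (wD _ uR).
have f_rel r : r \in R -> f r = 1.
  have: normal_closure [set` R] `<=` f @^-1` [set 1] by rewrite -ker_f.
  by move=> sub rR; apply: sub => N [_]; apply.
have act_rel r : r \in R -> forall q, word_act d p (word_of r) q = q.
  move=> rR [k y]; have [phi phiM ->] := act_loc k; last first.
    by rewrite inE rR orbT.
  by rewrite f_rel // chi1 cocycle1 (morphic1 phiM) mul1g GRing.addr0.
have act_t k y : word_act d p (word_of ut) (k, y) = ((k + 1)%R, y).
  have [phi phiM ->] := act_loc k; last by rewrite inE eqxx.
  by rewrite fut chi_t cocycle_t (morphic1 phiM) mul1g.
pose u_ x := xget 1 (f @^-1` [set x]).
have fu_ x : f (u_ x) = x.
  by rewrite /u_; case: xgetP => // nex; have [u /nex] := f_ex x.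
pose c x k := (word_act d p (word_of (u_ x)) (k, 1)).2.
have cE u k y :
    word_act d p (word_of u) (k, y) = ((k + chi (f u))%R, c (f u) k * y).
  rewrite (word_act_ker act_rel (v := u_ (f u))) ?fu_ //.
  rewrite -{1}[y]mul1g (word_act_mulr d p _ (k, 1) y) word_act1 /=.
  by rewrite word_shiftE fu_.
have cM x y k : c (x * y) k = c x (k + chi y)%R * c y k.
  have := cE (u_ x * u_ y) k 1; rewrite fM !fu_ mulg1.
  by rewrite [LHS]word_act_mul !cE !fu_ mulg1 => -[_ ->].
have c1 k : c 1 k = 1.
  apply: (@mulgI _ (c 1 k)).
  by rewrite mulg1 -{1}[k]GRing.addr0 -chi1 -cM mulg1.
have ct k : c t k = 1.
  by have := act_t k 1; rewrite cE fut mulg1 => -[_ ->].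
have cs_succ k : c (s (k + 1)%R) 0%R = c (s k) 0%R.
  by rewrite s_succ cM ct mul1g.
have cs k : c (s k) 0%R = 1.
  case: k => k; elim: k => [|k IHk].
  - by rewrite s0 c1.
  - by rewrite -IHk -[RHS]cs_succ; congr (c (s _) _); lia.
  - by rewrite -cs_succ s0 c1.
  - by rewrite -IHk -[LHS]cs_succ; congr (c (s _) _); lia.
exists (fun x => c (iota x) 0%R) => [x y|k i].
  rewrite iotaM cM GRing.add0r; congr (c _ _ * _).
  by have: range iota (iota y) by [exists y]; rewrite im_iota.
rewrite /cocycle iota_h ?chi_cocycle // !cM cs mulg1 chiM !chi_s.
rewrite (_ : c _^-1 _ = 1) ?mul1g.
  have := cE (fg_letter (i, false)) k 1.
  by rewrite !mulg1 /= /letter_act /= mulg1 -/(g i) GRing.add0r => -[->].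
apply: (@mulIg _ (c (s (k + chi (g i))%R) 0%R)).
rewrite mul1g cs -[RHS](c1 0%R) -(mulVg (s (k + chi (g i))%R)) cM chi_s.
by rewrite !cs !mulg1; congr c; lia.
Qed.

Lemma kernel_local_presentation :
  exists (L : nat), local_presentation gen L.
Proof.
have [ut fut] := f_ex t.
pose M := (\max_(i < n) `|d i|)%N.
pose D := (M * \max_(u <- ut :: R) size (word_of u))%N.
(* Folding does not increase distances, so heights within [D] of [k] have levels within [D] of
   [lev k]: at most [2 D + 1] levels. *)
exists (D + D).+1; split=> [|T p loc]; first exact: gen_ker.
pose lev (k : int) := match k with Posz m => m | Negz m => m end.
pose neg (k : int) := if k is Negz _ then true else false.
have dM i : (`|d i| <= M)%N by rewrite /M (bigmax_sup i).
have wD u : u \in ut :: R -> (M * size (word_of u) <= D)%N.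
  by move=> uR; rewrite /D leq_mul2l (bigmax_sup_seq u) ?orbT.
have [|phi phiM phip] :=
  @glue T (fun k i => p (lev k) (i, neg k)) M D ut fut dM wD; last first.
  by exists phi => // l [i b]; rewrite /gen; case: b => /=; exact: phip.
move=> k; have [phi phiM phip] := loc (lev k - D)%N.
exists phi => // k' i kk'.
have <- := phip (lev k') (i, neg k'); first by rewrite /gen; case: (k') => m.
by case: k kk' {phip} => k; case: k' => k' /=; lia.
Qed.

End KernelPresentation.

Lemma finitely_presented_Z_group_local (K : groupType) :
  finitely_presented_Z_group K ->
  exists (I : finType) (gen : nat -> I -> K) (L : nat),
    local_presentation gen L.
Proof.
move=> [G [chi [iota [[n [R [f [fM f_surj ker_f]]]] [chiM chi_surj]]]]].
move=> [iotaM iota_inj im_iota].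
have [L locL] := kernel_local_presentation
  fM f_surj ker_f chiM chi_surj iotaM iota_inj im_iota.
by do 3!eexists; exact: locL.
Qed.

(** * Blocks of levels and splicing of lifts *)

Lemma infinite_enum (T : Type) (A : set T) :
  infinite_set A -> exists2 f : nat -> T, injective f & forall i, A (f i).
Proof.
move=> /infiniteP/card_leP[f].
exists (fun i => set_val (f (SigSub (mem_set (I : [set: nat] i))))).
  move=> i j /val_inj fij.
  have := 'inj_f (mem_set I) (mem_set I) fij.
  by move=> /(congr1 set_val).
by move=> i; apply: set_valP.
Qed.

Section Blocks.
Variable a : nat -> nat.
Hypothesis a_incr : forall j, (a j < a j.+1)%N.

Lemma incr_ge j : (j <= a j)%N.
Proof. by elim: j => // j IHj; have := a_incr j; lia. Qed.

Lemma incr_mono j k : (j <= k)%N -> (a j <= a k)%N.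
Proof.
elim: k => [|k IHk]; first by rewrite leqn0 => /eqP->.
rewrite leq_eqVlt => /predU1P[-> //|]; rewrite ltnS => /IHk.
by have := a_incr k; lia.
Qed.

Lemma incr_block l : a 0 = 0 -> exists j, (a j <= l < a j.+1)%N.
Proof.
move=> a0; have ex : exists j, (l < a j.+1)%N by exists l; apply: incr_ge.
case: (ex_minnP ex) => -[|j] lj minj; first by exists 0; rewrite a0.
exists j.+1; rewrite lj andbT leqNgt; apply/negP => /minj; lia.
Qed.

End Blocks.

Section Lifts.
Variables (K : groupType) (I : finType) (gen : nat -> I -> K) (L : nat).
Hypothesis lpK : local_presentation gen L.

(** A window of [L] levels meets at most two blocks. If it meets two, its part in the first lies
    among the last [L] levels there, where both homomorphisms agree, so the second one serves the
    whole window. *)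
Lemma block_glue (T : groupType) (a : nat -> nat) (c : nat -> K -> T) :
  a 0 = 0 -> (forall j, a j + L < a j.+1)%N ->
  (forall j, {morph c j : x y / x * y}) ->
  (forall j l i, (a j.+1 <= l + L)%N -> (l < a j.+1)%N ->
     c j (gen l i) = c j.+1 (gen l i)) ->
  exists2 phi : K -> T, {morph phi : x y / x * y} &
    forall j l i, (a j <= l < a j.+1)%N -> phi (gen l i) = c j (gen l i).
Proof.
move=> a0 aL cM agree.
have a_incr j : (a j < a j.+1)%N by have := aL j; lia.
have [blk blkP] := choice (fun l => incr_block a_incr l a0).
have blkE j l : (a j <= l < a j.+1)%N -> blk l = j.
  move=> jl; have jl' := blkP l; apply/eqP; rewrite eqn_leq.
  by apply/andP; split; rewrite leqNgt; apply/negP => /(incr_mono a_incr); lia.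
have [k|phi phiM phip] := lp_glue lpK (p := fun l i => c (blk l) (gen l i)).
  have [bk1 bk2] := andP (blkP k).
  have [kL|kL] := leqP (k + L) (a (blk k).+1).
    by exists (c (blk k)) => // l i kl; rewrite (@blkE (blk k) l) //; lia.
  exists (c (blk k).+1) => // l i kl; have [lk|lk] := ltnP l (a (blk k).+1).
    by rewrite (@blkE (blk k) l); [apply/esym/agree|]; lia.
  by rewrite (@blkE (blk k).+1 l) //; have := aL (blk k).+1; lia.
by exists phi => // j l i /blkE jl; rewrite phip jl.
Qed.

Variables (S Q : finGroupType) (pi : S -> Q).
Hypothesis piM : {morph pi : x y / x * y}.
Hypothesis ker_abelian : forall x y, pi x = 1 -> pi y = 1 -> x * y = y * x.

(* Relatively to a given lift, the lifts of a homomorphism form an abelian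
   group; this is its subtraction. *)
Lemma lift_heap (f g h : K -> S) :
  {morph f : x y / x * y} -> {morph g : x y / x * y} ->
  {morph h : x y / x * y} ->
  pi \o f =1 pi \o g -> pi \o h =1 pi \o g ->
  {morph (fun x => f x * (g x)^-1 * h x) : x y / x * y}.
Proof.
move=> fM gM hM fg hg x y; rewrite fM gM hM invgM.
have gfh :
    f y * (g y)^-1 * ((g x)^-1 * h x) = (g x)^-1 * h x * (f y * (g y)^-1).
  apply: ker_abelian; first by rewrite piM morphicV // [pi _]fg mulgV.
  by rewrite piM morphicV // [pi (h x)]hg mulVg.
by have := congr1 (fun z => f x * z * h y) gfh; rewrite /= !mulgA.
Qed.

Definition lifts (phi0 : K -> S) : set (K -> S) :=
  [set phi : K -> S | {morph phi : x y / x * y} /\ pi \o phi =1 pi \o phi0].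

(** Two lifts with equal values below [a] and on a window of length [L] at [b] have a difference
    vanishing there. Added to [phi0], it can be cut off at [b]. *)
Lemma lift_small_support (phi0 : K -> S) :
  {morph phi0 : x y / x * y} -> infinite_set (lifts phi0) ->
  forall a, exists (b : nat) (psi : K -> S),
    [/\ (a <= b)%N, {morph psi : x y / x * y},
        forall l i, (l < a)%N || (b <= l)%N -> psi (gen l i) = phi0 (gen l i) &
        exists l i, psi (gen l i) != phi0 (gen l i)].
Proof.
move=> phi0M inf a; have [F F_inj liftF] := infinite_enum inf.
have FM i : {morph F i : x y / x * y} by have [] := liftF i.
have F_sep ij : exists l, ij.1 != ij.2 ->
    exists i, F ij.1 (gen l i) != F ij.2 (gen l i).
  case: ij => i j /=; have [|ij] := eqVneq i j; first by exists 0.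
  apply: contrapT => noL; move/eqP: ij; apply; apply: F_inj.
  apply: funext => x; move: x; apply: (lp_gen lpK).
    exact: subgroup_eq.
  move=> l x; apply: contrapT => ne; apply: noL; exists l => _; exists x.
  exact/eqP.
have [sep sepP] := choice F_sep.
pose P : finType := ({ffun 'I_a * I -> S} * {ffun 'I_L * I -> S})%type.
pose pattern b (phi : K -> S) : P :=
  ([ffun li : 'I_a * I => phi (gen li.1 li.2)],
   [ffun li : 'I_L * I => phi (gen (b + li.1)%N li.2)]).
pose C := #|P|.
pose b := maxn a (\max_(ij : 'I_C.+1 * 'I_C.+1) (sep (val ij.1, val ij.2)).+1).
have ltb (i j : 'I_C.+1) : (sep (val i, val j) < b)%N.
  by rewrite /b leq_max; apply/orP; right; rewrite (bigmax_sup (i, j)).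
(* The number [C] of patterns does not depend on the position [b] of the second
   window, so [b] can be chosen beyond the levels separating [C + 1] lifts. *)
have: ~~ injectiveb (fun i : 'I_C.+1 => pattern b (F i)).
  by apply/negP => /injectiveP/leq_card; rewrite card_ord ltnn.
case/injectivePn => i [j ij] [/ffunP pa /ffunP pw].
have lift_fg : pi \o F i =1 pi \o F j.
  by move=> x; have [_ ->] := liftF i; have [_ ->] := liftF j.
have lift_hg : pi \o phi0 =1 pi \o F j.
  by move=> x; have [_ ->] := liftF j.
have psiM := lift_heap (FM i) (FM j) phi0M lift_fg lift_hg.
set psi := (fun x => _) in psiM.
have psi0 l x : F i (gen l x) = F j (gen l x) -> psi (gen l x) = phi0 (gen l x).
  by rewrite /psi => ->; rewrite mulgV mul1g.
have psi_a l x : (l < a)%N -> psi (gen l x) = phi0 (gen l x).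
  by move=> la; apply: psi0; have := pa (Ordinal la, x); rewrite !ffunE.
have psi_b l x : (b <= l < b + L)%N -> psi (gen l x) = phi0 (gen l x).
  move=> lb; have lL : (l - b < L)%N by lia.
  apply: psi0; have := pw (Ordinal lL, x); rewrite !ffunE /= subnKC //; lia.
(* [psi] and [phi0] agree on the [L] levels from [b] on, so a window starting at or before [b] sees
   only [psi], and a later one only [phi0]. *)
have [k|phi phiM phip] := lp_glue lpK
    (p := fun l x => if (l < b)%N then psi (gen l x) else phi0 (gen l x)).
  have [kb|kb] := leqP k b.
    exists psi => // l x kl; case: ltnP => // bl; apply: psi_b; lia.
  by exists phi0 => // l x kl; case: ltnP => // bl; lia.
exists b, phi; split=> // [|l x|]; first exact: leq_maxl.
  rewrite phip => lab; case: ltnP => // lb; apply: psi_a; lia.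
have [|x Fij] := sepP (val i, val j); first exact: ij.
exists (sep (val i, val j)), x; rewrite phip ltb; apply: contra Fij => /eqP.
by rewrite /psi -[RHS]mul1g => /mulIg/eqP; rewrite divg_eq1.
Qed.

Lemma lift_dense_support (phi0 : K -> S) :
  {morph phi0 : x y / x * y} -> infinite_set (lifts phi0) ->
  exists (phi : K -> S) (a : nat -> nat),
    [/\ {morph phi : x y / x * y}, a 0 = 0, forall j, (a j + L < a j.+1)%N,
        forall j l i, (a j.+1 <= l + L)%N -> (l < a j.+1)%N ->
          phi (gen l i) = phi0 (gen l i) &
        forall j, exists l i,
          (a j <= l < a j.+1)%N /\ phi (gen l i) != phi0 (gen l i)].
Proof.
move=> phi0M inf.
have small a : exists b_psi : nat * (K -> S),
    [/\ (a <= b_psi.1)%N, {morph b_psi.2 : x y / x * y},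
        forall l i, (l < a)%N || (b_psi.1 <= l)%N ->
          b_psi.2 (gen l i) = phi0 (gen l i) &
        exists l i, b_psi.2 (gen l i) != phi0 (gen l i)].
  by have [b [psi bpsi]] := lift_small_support phi0M inf a; exists (b, psi).
have [next nextP] := choice small.
(* The summand [L] leaves a gap as long as a window after the support of the perturbation; the
   summand 1 makes [aL] strict. *)
pose a := fix a j := if j is j'.+1 then (next (a j')).1 + L + 1 else 0.
have a_next j : a j.+1 = ((next (a j)).1 + L + 1)%N by [].
have aL j : (a j + L < a j.+1)%N.
  by have [? _ _ _] := nextP (a j); rewrite a_next; lia.
have psi_out j l i : (l < a j)%N || (a j.+1 <= l + L.+1)%N ->
    (next (a j)).2 (gen l i) = phi0 (gen l i).
  have [_ _ out _] := nextP (a j); rewrite a_next => lout; apply: out; lia.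
have [|||phi phiM phip] := @block_glue S a (fun j => (next (a j)).2) _ aL.
- by [].
- by move=> j; have [] := nextP (a j).
- by move=> j l i l1 l2; rewrite !psi_out //; lia.
exists phi, a; split=> // [j l i l1 l2|j].
  by rewrite (phip j) ?psi_out //; have := aL j; lia.
have [_ _ _ [l [i psi_li]]] := nextP (a j).
have jl : (a j <= l < a j.+1)%N.
  by rewrite -[_ && _]negbK negb_and; apply: contra psi_li => nl;
    rewrite psi_out //; lia.
by exists l, i; rewrite (phip j).
Qed.

End Lifts.

(** * Index, stabilizers and a diagonal argument *)

Lemma has_indexP (K : groupType) (H : set K) (m : nat) :
  is_subgroup H ->
  has_index H m <-> exists q : K -> 'I_m,
    (forall i, exists x, q x = i) /\ forall x y, q x = q y <-> H (x^-1 * y).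
Proof.
move=> [H1 HM HV]; pose coset x : set K := [set x * h | h in H].
have cosetE x y : coset x = coset y <-> H (x^-1 * y).
  split=> [xy|Hxy].
    have : coset y y by exists 1; rewrite // mulg1.
    by rewrite -xy => -[h Hh <-]; rewrite mulKg.
  apply/seteqP; split=> z [h Hh <-].
    exists ((x^-1 * y)^-1 * h); first by apply: HM => //; apply: HV.
    by rewrite invgM invgK !mulgA mulgV mul1g.
  by exists (x^-1 * y * h); [exact: HM | rewrite !mulgA mulgV mul1g].
split=> [/card_set_bijP[f [f_fun f_inj f_surj]]|[q [q_surj qE]]].
  have inH x : left_cosets H (coset x) by exists x.
  exists (fun x => Ordinal (f_fun _ (inH x))); split=> [i|x y].
    by have [_ [x _ <-] fx] := f_surj i (ltn_ord i); exists x; apply: val_inj.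
  rewrite -cosetE; split=> [/(congr1 val)/= fxy|xy]; last first.
    by apply: val_inj; rewrite /= xy.
  by apply: f_inj fxy; rewrite inE.
pose f (A : set K) : nat := q (xget 1 [set x | A = coset x]).
have fE x : f (coset x) = q x.
  rewrite /f; case: xgetP => [y _ xy|/(_ x)[]//].
  by congr (val _); apply/qE/cosetE; rewrite -xy.
apply/card_set_bijP; exists f; split.
- by move=> _ [x _ <-]; rewrite /= fE.
- move=> _ _ /set_mem[x _ <-] /set_mem[y _ <-]; rewrite !fE => /val_inj.
  by move=> /qE/cosetE.
- move=> i im; have [x qx] := q_surj (Ordinal im).
  by exists (coset x); [exists x | rewrite fE qx].
Qed.

Lemma stabilizer_index (K : groupType) (T : finType) (act : K -> {perm T})
    (u : T) (A : {set T}) :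
  {morph act : x y / x * y} ->
  (forall x, act x u \in A) -> (forall v, v \in A -> exists x, act x u = v) ->
  subgroups_of_index K #|A| [set x | act x u = u].
Proof.
move=> actM Au A_orbit.
have subK : is_subgroup [set x | act x u = u].
  split=> [|x y /= xu yu|x /= xu]; rewrite /mkset.
  - by rewrite morphic1 // perm1.
  - by rewrite actM permM xu.
  - by rewrite morphicV // -{1}xu permK.
split=> //; apply/has_indexP => //.
(* Permutations compose from left to right, so [act x u] depends on a right coset; the inverse turns
   it into a left one. *)
exists (fun x => enum_rank_in (Au 1) (act x^-1 u)); split=> [i|x y].
  have [|x xi] := A_orbit (enum_val i); first exact: enum_valP.
  by exists x^-1; rewrite invgK xi enum_valK_in.
rewrite /mkset actM permM; split.
  move=> /(congr1 enum_val); rewrite !enum_rankK_in // => ->.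
  by rewrite morphicV // permKV.
move=> xyu; congr enum_rank_in.
by rewrite -[LHS](permK (act y)) xyu (morphicV actM y).
Qed.

Lemma cantor_not_countable (T : Type) (A : set T) (f : (nat -> bool) -> T) :
  injective f -> (forall e, A (f e)) -> ~ countable A.
Proof.
move=> f_inj fA /countable_injP[c c_inj].
have cf_inj : injective (c \o f).
  by move=> e e' /c_inj cc; apply/f_inj/cc; rewrite inE.
pose diag n := `[< exists2 e, c (f e) = n & ~~ e n >].
have := erefl (diag (c (f diag))); rewrite {1}/diag.
case: asboolP => [[e /cf_inj -> /negbTE ->]//|ne] /esym dd.
by case: ne; exists diag; rewrite ?dd.
Qed.

(** * Uncountably many stabilizers of index [m] *)

Section TwoSidedAction.
Variables (S : finGroupType) (e : nat).
Local Notation T := (S + 'I_e)%type.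

Definition two_sided_fun (g h : S) (v : T) : T :=
  if v is inl y then inl (g^-1 * y * h) else v.

Lemma two_sided_inj g h : injective (two_sided_fun g h).
Proof. by move=> [y|i] [z|j] //= -[/mulIg/mulgI->]. Qed.

Definition two_sided g h : {perm T} := perm (@two_sided_inj g h).

Lemma two_sidedM g g' h h' :
  two_sided (g * g') (h * h') = two_sided g h * two_sided g' h'.
Proof.
by apply/permP => -[y|i]; rewrite permM !permE //= invgM !mulgA.
Qed.

End TwoSidedAction.

Section UncountablyMany.
Variables (K : groupType) (I : finType) (gen : nat -> I -> K) (L : nat).
Hypothesis lpK : local_presentation gen L.
Variables (S : finGroupType) (phi0 phi : K -> S) (a : nat -> nat) (m : nat).
Hypothesis phi0M : {morph phi0 : x y / x * y}.
Hypothesis phiM : {morph phi : x y / x * y}.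
Hypothesis a0 : a 0 = 0.
Hypothesis aL : forall j, (a j + L < a j.+1)%N.
Hypothesis phi_gap : forall j l i, (a j.+1 <= l + L)%N -> (l < a j.+1)%N ->
  phi (gen l i) = phi0 (gen l i).
Hypothesis phi_block : forall j, exists l i,
  (a j <= l < a j.+1)%N /\ phi (gen l i) != phi0 (gen l i).
Hypothesis leSm : (#|S| <= m)%N.

Let a_incr j : (a j < a j.+1)%N.
Proof. by have := aL j; lia. Qed.

Let O : {set S} := [set y | `[< exists x, y = (phi0 x)^-1 * phi x >]].
Let e := (m - #|O|)%N.
Let T : finType := (S + 'I_e)%type.
Let A : {set T} := [set v : T | if v is inl y then y \in O else true].
Let base : T := inl 1.

Let leOS : (#|O| <= #|S|)%N. Proof. exact: max_card. Qed.

Let OP y : reflect (exists x, y = (phi0 x)^-1 * phi x) (y \in O).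
Proof. by rewrite inE; apply: asboolP. Qed.

Let baseA : base \in A.
Proof.
rewrite inE; apply/OP; exists 1.
by rewrite (morphic1 phi0M) (morphic1 phiM) mulVg.
Qed.

Let cardA : #|A| = m.
Proof.
rewrite -sum1_card big_sumType /=.
under eq_bigl do rewrite inE; under [X in (_ + X)%N]eq_bigl do rewrite inE.
by rewrite !sum1_card cardT size_enum_ord subnKC // (leq_trans leOS).
Qed.

Let rho (x : K) : {perm T} := two_sided e (phi0 x) (phi x).
Let delta (x : K) : {perm T} := two_sided e (phi0 x) (phi0 x).

(* For [v] outside [S], the transposition commutes with [delta], so [twist v] and
   [rho] can be spliced, but [twist v] fixes [base]. *)
Let twist (v : T) (x : K) : {perm T} := rho x ^ tperm base v.

(* Without extra points, i.e. for [e = 0], the whole of [S] is the orbit [O], so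
   that [delta] itself preserves the orbit. *)
Let fixing (x : K) : {perm T} :=
  if [pick i : 'I_e] is Some i then twist (inr i) x else delta x.

Let rhoM : {morph rho : x y / x * y}.
Proof. by move=> x y; rewrite /rho phi0M phiM two_sidedM. Qed.

Let deltaM : {morph delta : x y / x * y}.
Proof. by move=> x y; rewrite /delta phi0M two_sidedM. Qed.

Let twistM v : {morph twist v : x y / x * y}.
Proof. by move=> x y; rewrite /twist rhoM conjMg. Qed.

Let fixingM : {morph fixing : x y / x * y}.
Proof. by rewrite /fixing; case: pickP => [i _|_]; [exact: twistM|]. Qed.

Let delta_base x : delta x base = base.
Proof. by rewrite permE /= mulg1 mulVg. Qed.

Let delta_inr x i : delta x (inr i) = inr i.
Proof. by rewrite permE. Qed.

Let rho_delta x : phi x = phi0 x -> rho x = delta x.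
Proof. by rewrite /rho => ->. Qed.

Let twist_delta i x : phi x = phi0 x -> twist (inr i) x = delta x.
Proof.
move=> /rho_delta rx; rewrite /twist rx; apply/conjg_fixP/commgP/commute_sym.
by apply/commgP/conjg_fixP; rewrite tpermJ delta_base delta_inr.
Qed.

Let fixing_delta x : phi x = phi0 x -> fixing x = delta x.
Proof. by rewrite /fixing; case: pickP => // i _; apply: twist_delta. Qed.

Let fixing_base x : fixing x base = base.
Proof.
rewrite /fixing; case: pickP => [i _|_]; last exact: delta_base.
have := permJ (rho x) (tperm base (inr i)) (inr i).
by rewrite tpermR [rho x _]permE /= tpermR.
Qed.

Let rho_base x : rho x base = inl ((phi0 x)^-1 * phi x).
Proof. by rewrite permE /= mulg1. Qed.

Let rhoA x v : (rho x v \in A) = (v \in A).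
Proof.
have imp z w : w \in A -> rho z w \in A.
  rewrite !inE permE; case: w => //= y /OP[y' ->]; apply/OP; exists (y' * z).
  by rewrite phi0M phiM invgM !mulgA.
apply/idP/idP => [/(imp x^-1)|]; last exact: imp.
by rewrite (morphicV rhoM) permK.
Qed.

Let twistA i x v : (twist (inr i) x v \in A) = (v \in A).
Proof.
have tA w : (tperm base (inr i) w \in A) = (w \in A).
  by case: tpermP => [->|->|//]; rewrite baseA inE.
by rewrite /twist conjgE !permM tA rhoA tpermV tA.
Qed.

Let fixingA x v : (fixing x v \in A) = (v \in A).
Proof.
rewrite /fixing; case: pickP => [i _|e0]; first exact: twistA.
have e_eq0 : e = 0.
  by case: (posnP e) => // e_gt0; have := e0 (Ordinal e_gt0).
suff -> : A = finset.setT by rewrite !inE.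
have OT : O = finset.setT.
  apply/eqP; rewrite eqEcard finset.subsetT cardsT /=.
  by rewrite (leq_trans leSm) // -subn_eq0 -/e e_eq0.
by apply/setP => -[y|i]; rewrite /A OT !inE.
Qed.

(** Each [z] is a product of finitely many generators and their inverses; [B] exceeds their
    levels. *)
Let reach (z : K) : exists B : nat, forall f : K -> {perm T},
  {morph f : x y / x * y} ->
  (forall l i, (l < B)%N -> f (gen l i) = rho (gen l i)) -> f z = rho z.
Proof.
move: z; apply: (lp_gen lpK); first split.
- by exists 0 => f fM _; rewrite (morphic1 fM) (morphic1 rhoM).
- move=> x y [Bx xB] [By yB]; exists (maxn Bx By) => f fM fB.
  rewrite fM rhoM xB ?yB // => l i lB; apply: fB; lia.
- move=> x [B xB]; exists B => f fM fB.
  by rewrite (morphicV fM) (morphicV rhoM) xB.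
- by move=> l i; exists l.+1 => f fM; apply.
Qed.

Lemma uncountably_many_subgroups : ~ countable (subgroups_of_index K m).
Proof.
have repr (y : S) : exists z, y \in O -> y = (phi0 z)^-1 * phi z.
  by have [/OP[z yz]|] := boolP (y \in O); [exists z | exists 1].
have [rep repP] := choice repr; have [lev levP] := choice reach.
(* Since [j <= a j], every level below [j0] lies in one of the first [j0] blocks, so each [rep y]
   acts as under [rho]. *)
pose j0 := \max_(y : S) lev (rep y).
(* The first [j0] blocks make [base] reach [O], the next [e] ones attach the
   extra points to its orbit, and the remaining ones encode [eps]. *)
pose c (eps : nat -> bool) (j : nat) : K -> {perm T} :=
  if (j < j0)%N then rho else
  if insub (j - j0)%N is Some i then twist (inr i) else
  if eps (j - (j0 + e))%N then rho else fixing.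
have cM eps j : {morph c eps j : x y / x * y}.
  rewrite /c; case: ifP => // _; case: insubP => [i _ _|_]; first exact: twistM.
  by case: ifP.
have c_delta eps j x : phi x = phi0 x -> c eps j x = delta x.
  move=> xx; rewrite /c; case: ifP => _; first exact: rho_delta.
  case: insubP => [i _ _|_]; first exact: twist_delta.
  by case: ifP => _; [exact: rho_delta | exact: fixing_delta].
have cA eps j x v : (c eps j x v \in A) = (v \in A).
  rewrite /c; case: ifP => _; first exact: rhoA.
  case: insubP => [i _ _|_]; first exact: twistA.
  by case: ifP => _; [exact: rhoA | exact: fixingA].
have Om_ex eps : exists Om : K -> {perm T}, {morph Om : x y / x * y} /\
    forall j l i, (a j <= l < a j.+1)%N -> Om (gen l i) = c eps j (gen l i).
  have [| Om OmM Omc] := block_glue lpK a0 aL (cM eps); last by exists Om.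
  by move=> j l i l1 l2; rewrite !c_delta // (@phi_gap j).
have [Om /all_and2[OmM OmC]] := choice Om_ex.
have OmA eps x : forall v, (Om eps x v \in A) = (v \in A).
  move: x; apply: (lp_gen lpK); first split.
  - by move=> v; rewrite morphic1 // perm1.
  - by move=> x y xA yA v; rewrite OmM permM yA xA.
  - by move=> x xA v; rewrite morphicV // -xA permKV.
  move=> l i v.
  have [j jl] := incr_block a_incr l a0.
  by rewrite (OmC eps j).
have Om_rep eps y : y \in O -> Om eps (rep y) base = inl y.
  move=> yO; rewrite levP // => [|l i ly]; first by rewrite rho_base -repP.
  have lj0 : (l < j0)%N by rewrite (leq_trans ly) // /j0 (bigmax_sup y).
  have [j jl] := incr_block a_incr l a0.
  rewrite (OmC eps j) // /c ifT //; have := incr_ge a_incr j; lia.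
have Om_orbit eps v : v \in A -> exists x, Om eps x base = v.
  case: v => [y|i]; first by rewrite inE => yO; exists (rep y); apply: Om_rep.
  move=> _; have [l [i' [jl ne]]] := phi_block (j0 + i).
  set x := gen l i' in ne; pose y := (phi0 x)^-1 * phi x.
  have yO : y \in O by apply/OP; exists x.
  have ny : inl y != base :> T.
    by apply: contra ne => /eqP[/eqP]; rewrite mulg_eq1 eqg_inv eq_sym.
  (* [rep y] takes [base] to [inl y]. In this block [x] acts as [rho x] conjugated by the
     transposition of [base] and [inr i], which fixes [inl y]; hence [x] takes [inr i] to [inl y],
     and [x^-1] goes back. *)
  exists (rep y * x^-1); rewrite OmM permM Om_rep // (morphicV (OmM eps)).
  apply: (canLR (permK _)); rewrite (OmC _ (j0 + i)) // /c ltnNge leq_addr /=.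
  rewrite addKn (valK i).
  have := permJ (rho x) (tperm base (inr i)) base.
  by rewrite tpermL rho_base -/y tpermD // eq_sym.
apply: (@cantor_not_countable _ _ (fun eps => [set x | Om eps x base = base])).
  move=> eps eps' eqH; apply: funext => k.
  have [l [i [jl ne]]] := phi_block (j0 + e + k).
  (* Here [phi] and [phi0] differ at [gen l i], so [rho] moves [base] while [fixing] does not:
     membership of this generator reads off digit [k]. *)
  have digit eps1 : [set x | Om eps1 x base = base] (gen l i) <-> ~~ eps1 k.
    rewrite /mkset (OmC _ (j0 + e + k)) // /c ifF; last lia.
    rewrite insubF; last lia.
    rewrite addKn; case: ifP => _; last by split.
    rewrite rho_base; split=> // -[/eqP].
    by rewrite mulg_eq1 eqg_inv eq_sym (negPf ne).
  apply: negb_inj; apply/idP/idP => /digit h; apply/digit.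
    by rewrite -eqH.
  by rewrite eqH.
move=> eps; rewrite -[X in subgroups_of_index K X]cardA.
by apply: stabilizer_index => // [x|v]; [rewrite OmA | exact: Om_orbit].
Qed.

End UncountablyMany.

(** * Reduction to homomorphisms into solvable groups *)

Definition homs (K T : groupType) : set (K -> T) :=
  [set phi : K -> T | {morph phi : x y / x * y}].

(** Induction on the order of [S]: a minimal normal subgroup [M] is abelian. Infinitely many
    homomorphisms to the quotient by [M] allow descent; otherwise one of them has infinitely many
    lifts. *)
Lemma solvable_homs_uncountable (K : groupType) (I : finType)
    (gen : nat -> I -> K) (L : nat) (S : finGroupType) (m : nat) :
  local_presentation gen L -> solvable [set: S]%SET ->
  infinite_set (@homs K S) -> (#|S| <= m)%N ->
  ~ countable (subgroups_of_index K m).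
Proof.
move=> lpK; have [n] := ubnP #|S|; elim: n S => // n IHn S ltSn solS infS leSm.
have ntS : [set: S]%G != 1%G.
  apply/eqP => S1; have [F F_inj _] := infinite_enum infS.
  suff /F_inj : F 0 = F 1%N by [].
  apply: funext => x; have in1 y : y = 1 :> S.
    by apply/set1P; rewrite -[[set 1]%SET]/(val 1%G) -S1 inE.
  by rewrite [LHS]in1 [RHS]in1.
have [M minM sMS] := minnormal_exists ntS (normG _).
have [nMS ntM /abelem_abelian/centsP abM] :=
  minnormal_solvable minM sMS solS.
have nM x : x \in 'N(M) by apply: (fintype.subsetP nMS); rewrite inE.
have piM : {morph coset M : x y / x * y}.
  by move=> x y; rewrite morphM // nM.
have ker_abelian x y : coset M x = 1 -> coset M y = 1 -> x * y = y * x.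
  by move=> /(coset_idr (nM x)) xM /(coset_idr (nM y)) yM; apply: abM.
have [finQ|infQ] := pselect (finite_set (@homs K (coset_of M))); last first.
  have quoT := quotientT M.
  have leQ : (#|{: coset_of M}| < #|S|)%N.
    by rewrite -!cardsT -quoT ltn_quotient.
  apply: (IHn (coset_of M)) => //.
  - exact: leq_trans leQ _.
  - by rewrite -quoT quotient_sol.
  - exact: leq_trans (ltnW leQ) leSm.
have [phi0 phi0M inf0] : exists2 phi0 : K -> S, homs phi0 &
    infinite_set (lifts (coset M) phi0).
  apply: contrapT => fin; apply: infS.
  apply: (@sub_finite_set _ _ (\bigcup_(psi in @homs K (coset_of M))
            [set phi : K -> S | homs phi /\ coset M \o phi =1 psi])).
    move=> phi phiM; exists (coset M \o phi) => //.
    by move=> x y; rewrite /= phiM piM.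
  apply: bigcup_finite => // psi psiM; apply: contrapT => inf; apply: fin.
  have [phi0 [phi0M phi0E]] := infinite_setN0 inf.
  exists phi0 => //; apply: contra_not inf; apply: sub_finite_set => phi.
  by case=> phiM phiE; split=> // x; rewrite phiE phi0E.
have [phi [a [phiM a0 aL gap block]]] :=
  lift_dense_support lpK piM ker_abelian phi0M inf0.
exact: (uncountably_many_subgroups lpK phi0M phiM a0 aL gap block leSm).
Qed.

(** A subgroup of index [r] is a point stabilizer in the action on its cosets, so it is determined
    by a homomorphism and a point. *)
Lemma infinite_subgroups_homs (K : groupType) (r : nat) :
  infinite_set (subgroups_of_index K r) -> infinite_set (@homs K {perm 'I_r}).
Proof.
apply: contra_not => fin.
pose stab (fi : (K -> {perm 'I_r}) * 'I_r) := [set x | fi.1 x fi.2 = fi.2].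
apply: (@sub_finite_set _ _
  (stab @` (@homs K {perm 'I_r} `*` [set: 'I_r]))); last first.
  by apply: finite_image; apply: finite_setX => //; apply: finite_finset.
move=> H [subH /(has_indexP _ subH)[q [q_surj qE]]].
have [c cK] := choice q_surj.
have qM z x y : q x = q y -> q (z * x) = q (z * y).
  by move=> /qE xy; apply/qE; rewrite invgM -mulgA mulKg.
have act_inj x : injective (fun i => q (x^-1 * c i)).
  by move=> i j /(qM x); rewrite !mulVKg !cK.
pose act x := perm (@act_inj x).
exists (act, q 1); first split=> // x y.
  apply/permP => i; rewrite permM !permE invgM -mulgA.
  by apply: qM; rewrite cK.
apply/seteqP; split=> x; rewrite /stab /= permE (qM _ _ 1) ?cK // mulg1.
  by move=> /qE; rewrite invgK mulg1.
by move=> Hx; apply/qE; rewrite invgK mulg1.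
Qed.

Theorem corollary3p5 (K : groupType) (r : nat)
    (hK : finitely_presented_Z_group K)
    (hr : r \in [:: 2; 3; 4])
    (hinf : infinite_set (subgroups_of_index K r)) :
  forall m : nat, (r`! <= m)%N -> ~ countable (subgroups_of_index K m).
Proof.
move=> m le_m; have [I [gen [L lpK]]] := finitely_presented_Z_group_local hK.
apply: (solvable_homs_uncountable (S := {perm 'I_r}) lpK).
(* The orders 2, 6 and 24 have at most two prime divisors. *)
- apply: Burnside_p_a_q_b; rewrite cardsT card_Sn.
  by move: hr; rewrite !inE => /or3P[] /eqP->.
- exact: infinite_subgroups_homs.
- by rewrite card_Sn.
Qed.
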